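(* The Hitting Set problem for a family of sets $\{S_1,S_2,\dots,S_m\}$ with budget $d>0$ reduces to finding a feasible set of influencers for a target agent in a network with $n+1$ agents, where $n=\left|\bigcup_{k=1}^m S_k\right|+d+1$, consistent with $m+d+2$ examples from a majority dynamics protocol.
   Context: Hitting Set problem: given a family of (finite) sets $\{S_1,\dots,S_m\}$ and a budget $d>0$, find, if possible, a set $C\subseteq\bigcup_{k=1}^m S_k$ of size $d$ that has non-empty intersection with every $S_k$, $k=1,\dots,m$. Feasible influencer problem under majority dynamics: $N=[n]$ is a set of agents and $i$ is an additional target agent (so $n+1$ agents in total). A network labelling is a function $\ell:N\to\{\phi,\neg\phi\}$; $\ell(j)=\phi$ means $j$ agrees with agent $i$, $\ell(j)=\neg\phi$ means $j$ disagrees with $i$. For $F\subseteq N$, the majority protocol is the boolean sentence $$f^{+}(\ell,F):\quad \sum_{j\in F}\big(\mathbf 1(\ell(j)\neq\phi)-\mathbf 1(\ell(j)=\phi)\big)>0,$$ which is True if agent $i$ changes opinion. An example is a pair $(\ell,y)$ of a labelling $\ell$ and a truth value $y$ (the oracle's prediction of whether agent $i$ changes opinion). Given examples $(\ell_1,y_1),\dots,(\ell_{\hat m},y_{\hat m})$, a set $F\subseteq N$ is a feasible set of influencers (consistent with the examples) if $f^+(\ell_k,F)=y_k$ for all $k$. The problem is to find such an $F$, if one exists. ''Reduces'' is meant in the usual sense for NP-hardness: a polynomial-time map from Hitting Set instances to instances of the feasible influencer problem of the stated size such that a hitting set of size $d$ exists if and only if a feasible set of influencers exists, and a hitting set can be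 recovered in polynomial time from a feasible set of influencers. *)

(* Defs.v *)
From HB Require Import structures.
From mathcomp Require Import all_boot all_order all_algebra.

Set Implicit Arguments.
Unset Strict Implicit.
Unset Printing Implicit Defensive.

Import Order.TTheory GRing.Theory Num.Theory.

(** * Polynomial time: deterministic multitape Turing machines *)

Inductive symbol := Bit of bool | Sep.

Definition word := seq symbol.

(* [None] is the blank. *)
Definition cell := option symbol.

Inductive move := Left | Stay | Right.

(* A two-way infinite tape: the cells to the left of the head, nearest first,
   and the cells from the head rightwards; all cells not listed are blank. *)
Definition tape := (seq cell * seq cell)%type.

Definition read (t : tape) : cell := head None t.2.

Definition write_move (t : tape) (am : cell * move) : tape :=
  let: (l, r) := t in
  let: (a, mv) := am in
  match mv with
  | Left => (behead l, head None l :: a :: behead r)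
  | Stay => (l, a :: behead r)
  | Right => (a :: l, behead r)
  end.

(* As the states and the cell symbols are finite in number, [delta] is a finite
   transition table. *)
Record machine := Machine {
  ntapes : nat; (* the machine has [ntapes.+1] tapes *)
  state : finType;
  start : state;
  halting : pred state;
  delta : state -> {ffun 'I_ntapes.+1 -> cell} ->
          state * {ffun 'I_ntapes.+1 -> cell * move} }.

Definition config (M : machine) :=
  (state M * {ffun 'I_(ntapes M).+1 -> tape})%type.

(* Halted configurations are fixed by [step], so that a run halts within [t]
   steps exactly when its configuration after [t] steps is halted. *)
Definition step (M : machine) (c : config M) : config M :=
  if halting c.1 then c else
  let: (q, w) := delta c.1 [ffun i => read (c.2 i)] in
  (q, [ffun i => write_move (c.2 i) (w i)]).

(* The input is on the first tape, the head being on its first letter. *)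
Definition init (M : machine) (w : word) : config M :=
  (start M, [ffun i => if i == ord0 then ([::], map Some w) else ([::], [::])]).

Fixpoint word_of_cells (r : seq cell) : word :=
  if r is Some a :: r' then a :: word_of_cells r' else [::].

(* The output is on the last tape, from the head up to the first blank. *)
Definition output (M : machine) (c : config M) : word :=
  word_of_cells (c.2 ord_max).2.

(* One machine, within one polynomial time bound in the length of the input,
   maps the input word [i a] to the output word [o a], for every [a : A]. *)
Definition polytime (A : Type) (i o : A -> word) : Prop :=
  exists (M : machine) (p : {poly nat}), forall a : A,
    let c := iter (p.[size (i a)])%R (@step M) (init M (i a)) in
    halting c.1 /\ output c = o a.

Definition enc_nat (n : nat) : word := rcons (nseq n (Bit true)) Sep.

Definition enc_set (n : nat) (A : {set 'I_n}) : word :=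
  rcons [seq Bit (i \in A) | i <- enum 'I_n] Sep.

(** * Hitting Set *)

(* The elements of the sets are named by numbers below [ground], some of which
   may occur in no set of the family. *)
Record hs_instance := HSInstance {
  ground : nat;
  sets : seq {set 'I_ground};
  budget : nat;
  budget_gt0 : 0 < budget }.

Definition hs_union (x : hs_instance) : {set 'I_(ground x)} :=
  \bigcup_(A <- sets x) A.

Definition hitting_set (x : hs_instance) (C : {set 'I_(ground x)}) : Prop :=
  [/\ C \subset hs_union x, #|C| = budget x &
      forall A, A \in sets x -> A :&: C != set0].
Arguments hitting_set : clear implicits.

(* The sets are given by their incidence vectors and the budget in unary: a
   network with more than [budget x] agents, such as the one an instance is
   reduced to, cannot be written down in time polynomial in the number of
   binary digits of [budget x].  If
   [budget x <= #|hs_union x|], without which there is no hitting set, the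
   unary budget is no longer than the incidence vectors. *)
Definition enc_hs (x : hs_instance) : word :=
  enc_nat (ground x) ++ enc_nat (budget x) ++
  flatten [seq enc_set A | A <- sets x].

(** * Feasible influencers under majority dynamics *)

Definition opinion := bool.
Definition phi : opinion := true.

Definition labelling (n : nat) := {ffun 'I_n -> opinion}.

Definition majority (n : nat) (l : labelling n) (F : {set 'I_n}) : bool :=
  (0 < \sum_(j in F) ((l j != phi)%:R - (l j == phi)%:R) :> int)%R.

(* [others] is the number of agents besides the target agent. *)
Record fi_instance := FIInstance {
  others : nat;
  examples : seq (labelling others * bool) }.

Definition agents (y : fi_instance) : nat := (others y).+1.

Definition feasible (y : fi_instance) (F : {set 'I_(others y)}) : Prop :=
  forall e, e \in examples y -> majority e.1 F = e.2.
Arguments feasible : clear implicits.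

Definition enc_example (n : nat) (e : labelling n * bool) : word :=
  [seq Bit (e.1 j == phi) | j <- enum 'I_n] ++ [:: Bit e.2; Sep].

Definition enc_fi (y : fi_instance) : word :=
  enc_nat (others y) ++ flatten [seq enc_example e | e <- examples y].

(* Main.v *)
Require Import Defs.
From HB Require Import structures.
From mathcomp Require Import all_boot all_order all_algebra.
From mathcomp Require Import zify.

Set Implicit Arguments.
Unset Strict Implicit.
Unset Printing Implicit Defensive.

Import Order.TTheory GRing.Theory Num.Theory.

(* Let [U] be the union of the sets and [d] the budget. The agents are the
   elements of [U] and [d + 1] marks [z], and in every example the target agent
   changes opinion. For a set of influencers consisting of [C] in [U] and of
   [Z] among the marks, the example where exactly the marks disagree says
   [#|C| < #|Z|]. The example where exactly [U] and the mark [z] disagree then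
   says that [z] is in [Z] and [#|Z| <= #|C| + 1]. Together they force all marks
   to be influencers and [#|C| = d]. Finally the example where exactly the set
   [A] and all marks but the first disagree compares [#|A :&: C| + d] with
   [#|C :\: A| + 1 = d - #|A :&: C| + 1], so it says that [C] hits [A].

   Polynomial time is proved for a language of structured programs (single
   steps, sequences, loops) on four tapes: each program becomes a machine whose
   states are the control points of the program, and running times are bounded
   compositionally. *)

(** * Machines from structured programs *)

(* Tapes are compared through their normal form without trailing blanks, which
   [scons] preserves. *)
Definition scons (a : cell) (s : seq cell) : seq cell :=
  if (a, s) is (None, [::]) then [::] else a :: s.

Definition strip (s : seq cell) : seq cell := foldr scons [::] s.

Definition norm (t : tape) : tape := (strip t.1, strip t.2).

(** An edit of a normal form is again a normal form, thanks to [scons], so programs can be reasoned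
    about on normal forms alone. *)
Definition put (t : tape) (am : option (cell * move)) : tape :=
  if am is Some (a, mv) then
    match mv with
    | Left => (behead t.1, scons (head None t.1) (scons a (behead t.2)))
    | Stay => (t.1, scons a (behead t.2))
    | Right => (scons a t.1, behead t.2)
    end
  else t.

Lemma head_scons a s : head None (scons a s) = a.
Proof. by case: a s => [a|] []. Qed.

Lemma behead_scons a s : behead (scons a s) = s.
Proof. by case: a s => [a|] []. Qed.

Lemma head_strip s : head None (strip s) = head None s.
Proof. by case: s => //= a s; rewrite head_scons. Qed.

Lemma behead_strip s : behead (strip s) = strip (behead s).
Proof. by case: s => //= a s; rewrite behead_scons. Qed.

Lemma strip_head_behead s : scons (head None s) (strip (behead s)) = strip s.
Proof. by case: s. Qed.

Lemma strip_Some w : strip (map Some w) = map Some w.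
Proof. by elim: w => //= a w ->. Qed.

Lemma word_of_cells_strip s : word_of_cells (strip s) = word_of_cells s.
Proof.
elim: s => //= -[a|] s /= IHs; first by rewrite /scons /= IHs.
by rewrite /scons; case: (strip s).
Qed.

Lemma word_of_cells_Some w : word_of_cells (map Some w) = w.
Proof. by elim: w => //= a w ->. Qed.

Lemma norm_write_move t am : norm (write_move t am) = put (norm t) (Some am).
Proof.
case: t am => [l r] [a []] /=; rewrite /norm /= ?behead_strip //.
by rewrite head_strip.
Qed.

(** On an empty half tape, writing back the blank just read creates an explicit blank cell. Normal
    forms hide it, which lets a machine, bound to write on every tape at each step, imitate the edit
    [None]. *)
Lemma norm_stay t : norm (write_move t (read t, Stay)) = norm t.
Proof. by case: t => l r; rewrite /norm /= /read /= strip_head_behead. Qed.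

(* All programs have four tapes: [T0] is the input and [T3] the output. *)
Inductive tape_index := T0 | T1 | T2 | T3.

(** Tuples instead of finite functions make four-tape configurations compute, so that most single
    steps hold by reduction. *)
Definition quad (X : Type) : Type := X * X * X * X.

Definition qget X (k : tape_index) (q : quad X) : X :=
  let: (a, b, c, d) := q in
  match k with T0 => a | T1 => b | T2 => c | T3 => d end.

Definition qset X (k : tape_index) (x : X) (q : quad X) : quad X :=
  let: (a, b, c, d) := q in
  match k with
  | T0 => (x, b, c, d) | T1 => (a, x, c, d)
  | T2 => (a, b, x, d) | T3 => (a, b, c, x)
  end.

Definition quad_of X (f : tape_index -> X) : quad X := (f T0, f T1, f T2, f T3).

Lemma qget_quad_of X (f : tape_index -> X) k : qget k (quad_of f) = f k.
Proof. by case: k. Qed.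

Lemma qget_qset X k (x : X) q : qget k (qset k x q) = x.
Proof. by case: k; case: q => [[[a b] c] d]. Qed.

Lemma qset_qset X k (x y : X) q : qset k x (qset k y q) = qset k x q.
Proof. by case: k; case: q => [[[a b] c] d]. Qed.

Definition reads (T : quad tape) : quad cell := quad_of (fun k => read (qget k T)).

Lemma qget_reads k T : qget k (reads T) = read (qget k T).
Proof. exact: qget_quad_of. Qed.

Definition edit : Type := option (cell * move).

Definition puts (T : quad tape) (w : quad edit) : quad tape :=
  quad_of (fun k => put (qget k T) (qget k w)).

Inductive prog :=
| Act of (quad cell -> quad edit)
| Seq of prog & prog
| While of (quad cell -> bool) & prog.

Fixpoint pstate (p : prog) : finType :=
  match p with
  | Act _ => unit
  | Seq p q => (pstate p + pstate q)%type
  | While _ p => option (pstate p)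
  end.

Fixpoint pstart (p : prog) : pstate p :=
  match p with
  | Act _ => tt
  | Seq p q => inl (pstart p)
  | While _ p => None
  end.

Definition idle : quad edit := quad_of (fun=> None).

(* The next state [None] means that the program has finished. In a loop, the
   state [None] is the evaluation of its guard. *)
Fixpoint pdelta (p : prog) :
    pstate p -> quad cell -> option (pstate p) * quad edit :=
  match p with
  | Act w => fun _ c => (None, w c)
  | Seq p q => fun s c =>
      match s with
      | inl s => let: (s', w) := pdelta s c in
          (Some (if s' is Some s1 then inl s1 else inr (pstart q)), w)
      | inr s => let: (s', w) := pdelta s c in (omap inr s', w)
      end
  | While b p => fun s c =>
      match s with
      | None => (if b c then Some (Some (pstart p)) else None, idle)
      | Some s => let: (s', w) := pdelta s c in (Some s', w)
      end
  end.

Fixpoint runs_from (p : prog) (t : nat) (s : pstate p) (T T' : quad tape) :=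
  if t is t'.+1 then
    let: (s', w) := pdelta s (reads T) in
    if s' is Some s1 then runs_from t' s1 (puts T w) T' else puts T w = T'
  else False.

(* [t] is an upper bound on the running time. *)
Definition runs (p : prog) (t : nat) (T T' : quad tape) :=
  runs_from t (pstart p) T T'.

(** * Running times of sequences and loops *)

Lemma leq_runs_from p t t' (s : pstate p) T T' :
  t <= t' -> runs_from t s T T' -> runs_from t' s T T'.
Proof.
elim: t t' s T => [|t IHt] [|t'] s T //= le_tt'.
by case: (pdelta s _) => -[s1|] w //; apply: IHt.
Qed.

Lemma leq_runs p t t' T T' : t <= t' -> runs p t T T' -> runs p t' T T'.
Proof. exact: leq_runs_from. Qed.

Lemma runs_act w T T' : puts T (w (reads T)) = T' -> runs (Act w) 1 T T'.
Proof. by []. Qed.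

(** The last step of [p] already enters the start state of [q], so the two bounds add up without
    overhead. *)
Lemma runs_seq p q t u T T1 T2 :
  runs p t T T1 -> runs q u T1 T2 -> runs (Seq p q) (t + u) T T2.
Proof.
move=> Hp Hq; rewrite /runs /=.
have inr_run v (s : pstate q) S : runs_from v s S T2 ->
    runs_from (p := Seq p q) v (inr s) S T2.
  elim: v s S => //= v IHv s S.
  by case: (pdelta s _) => -[s1|] w //=; apply: IHv.
move: Hp; rewrite /runs; elim: t (pstart p) T => //= t IHt s T.
case: (pdelta s _) => -[s1|] w /=; first exact: IHt.
by move->; apply: inr_run; apply: leq_runs_from Hq; rewrite leq_addl.
Qed.

Lemma puts_idle T : puts T idle = T.
Proof. by case: T => [[[a b] c] d]. Qed.

Lemma runs_while_end (b : quad cell -> bool) p T :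
  ~~ b (reads T) -> runs (While b p) 1 T T.
Proof. by rewrite /runs /= => /negPf->; rewrite puts_idle. Qed.

(** Each round costs one step more than its body, for the evaluation of the guard. *)
Lemma runs_while (b : quad cell -> bool) p t u T T1 T2 :
  b (reads T) -> runs p t T T1 -> runs (While b p) u T1 T2 ->
  runs (While b p) (t.+1 + u) T T2.
Proof.
move=> bT Hp Hq; rewrite /runs /= bT puts_idle.
move: Hp; rewrite /runs; elim: t (pstart p) {bT} T => //= t IHt s T.
case: (pdelta s _) => -[s1|] w /=; first exact: IHt.
by move->; apply: leq_runs_from Hq; rewrite leq_addl.
Qed.

(* The items of [s] passed so far are listed in reverse order, as are the
   cells to the left of a head. *)
Lemma runs_for A (s : seq A) (I : seq A -> seq A -> quad tape)
    (b : quad cell -> bool) p t :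
  (forall l x r, rev l ++ x :: r = s ->
     b (reads (I l (x :: r))) /\ runs p t (I l (x :: r)) (I (x :: l) r)) ->
  ~~ b (reads (I (rev s) [::])) ->
  runs (While b p) (size s * t.+1).+1 (I [::] s) (I (rev s) [::]).
Proof.
move=> step_I end_I.
suff run l r : rev l ++ r = s ->
    runs (While b p) (size r * t.+1).+1 (I l r) (I (rev s) [::]).
  exact: run.
elim: r l => [|x r IHr] l def_s.
  by rewrite -def_s cats0 revK in end_I *; apply: runs_while_end.
have [bI Ip] := step_I _ _ _ def_s.
rewrite /= mulSn -addnS; apply: runs_while bI Ip _; apply: IHr.
by rewrite rev_cons cat_rcons.
Qed.

(** * Compilation of programs into Turing machines *)

Definition ord_of (k : tape_index) : 'I_4 :=
  match k with
  | T0 => ord0 | T1 => Ordinal (isT : 1 < 4)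
  | T2 => Ordinal (isT : 2 < 4) | T3 => ord_max
  end.

Definition tape_index_of (i : 'I_4) : tape_index :=
  match val i with 0 => T0 | 1 => T1 | 2 => T2 | _ => T3 end.

Lemma ord_ofK : cancel ord_of tape_index_of. Proof. by case. Qed.

Definition prog_delta p (s : option (pstate p)) (c : {ffun 'I_4 -> cell}) :
    option (pstate p) * {ffun 'I_4 -> cell * move} :=
  let: (s', w) := if s is Some s1
    then pdelta s1 (quad_of (fun k => c (ord_of k))) else (None, idle) in
  (s', [ffun i => odflt (c i, Stay) (qget (tape_index_of i) w)]).

Definition prog_machine (p : prog) : machine :=
  @Machine 3 (option (pstate p)) (Some (pstart p)) (fun s => ~~ isSome s)
    (@prog_delta p).

Definition norms (T : {ffun 'I_4 -> tape}) : quad tape :=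
  quad_of (fun k => norm (T (ord_of k))).

(** A machine step and a [pdelta] step agree on normal forms, since the heads read the same cells
    there. The finished state halts and is fixed by [step], so a program ending before time [t] is
    still found in its final configuration. *)
Lemma iter_prog_machine p t (s : pstate p) (T : {ffun 'I_4 -> tape}) T' :
  runs_from t s (norms T) T' ->
  let c := iter t (@step (prog_machine p)) (Some s, T) in
  halting c.1 /\ norms c.2 = T'.
Proof.
have halted u U : iter u (@step (prog_machine p)) (None, U) = (None, U).
  by elim: u => //= u ->.
elim: t s T => // t IHt s T; rewrite iterSr /=.
rewrite {2 4}/step /= /prog_delta.
have -> : quad_of (fun k => [ffun i => read (T i)] (ord_of k)) =
    reads (norms T).
  have read_norm k : [ffun i => read (T i)] (ord_of k) = read (qget k (norms T)).
    by rewrite ffunE qget_quad_of /read head_strip.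
  by rewrite /reads /quad_of !read_norm.
case: (pdelta s _) => s' w /=.
set U := [ffun i => write_move _ _].
have norms_U : norms U = puts (norms T) w.
  have norm_U k : norm (U (ord_of k)) = put (norm (T (ord_of k))) (qget k w).
    rewrite !ffunE ord_ofK; case: (qget k w) => [am|]; last exact: norm_stay.
    exact: norm_write_move.
  by rewrite /norms /puts /quad_of !norm_U.
by case: s' => [s1|]; rewrite -norms_U; [apply: IHt | rewrite halted].
Qed.

Definition tape_at (l r : word) : tape := (map Some l, map Some r).

(** [output] reads from the head on, hence the demand that [T3] end with its head on the first
    letter. *)
Lemma polytime_prog (A : Type) (i o : A -> word) (p : prog) (q : {poly nat}) :
  (forall a, exists2 T, qget T3 T = tape_at [::] (o a) &
     runs p q.[size (i a)]%R
       (tape_at [::] (i a), tape_at [::] [::], tape_at [::] [::],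
        tape_at [::] [::]) T) ->
  polytime i o.
Proof.
move=> p_runs; exists (prog_machine p), q => a /=; have [T T_o T_runs] := p_runs a.
have norms_init : norms (init (prog_machine p) (i a)).2 =
    (tape_at [::] (i a), tape_at [::] [::], tape_at [::] [::], tape_at [::] [::]).
  by rewrite /norms /quad_of !ffunE /norm /tape_at /= strip_Some.
move: T_runs; rewrite -norms_init => /iter_prog_machine[halted norms_c].
split=> //; have := congr1 (qget T3) norms_c; rewrite T_o qget_quad_of => -[_ out].
by rewrite -[RHS]word_of_cells_Some -out word_of_cells_strip.
Qed.

(** * Building blocks *)

Notation "p ;; q" := (Seq p q) (at level 65, right associativity).

Definition is_bit (c : cell) : bool := if c is Some (Bit _) then true else false.

Definition bit (c : cell) : bool := if c is Some (Bit b) then b else false.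

Definition write (b : bool) : edit := Some (Some (Bit b), Right).

Definition pass (c : cell) : edit := Some (c, Right).

Definition shift (k : tape_index) (mv : move) : prog :=
  Act (fun c => qset k (Some (qget k c, mv)) idle).

(** The first move is unconditional, because the head may rest on the blank just after the word; the
    loop then runs to the blank before the word. *)
Definition rewind (k : tape_index) : prog :=
  shift k Left ;; While (fun c => isSome (qget k c)) (shift k Left) ;;
  shift k Right.

Definition scan (w : quad cell -> quad edit) : prog :=
  While (fun c => is_bit (qget T0 c)) (Act w) ;; shift T0 Right.

Definition out (x : symbol) : prog := Act (fun=> qset T3 (Some (Some x, Right)) idle).

Lemma runs_rewind k l r T :
  qget k T = tape_at l r ->
  runs (rewind k) (2 * size l + 3) T (qset k (tape_at [::] (rev l ++ r)) T).
Proof.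
(* In [gap w] the head is on the blank just before [w], where the loop stops. *)
pose gap w : tape := ([::], scons None (map Some w)).
have shift_left S x u v : qget k S = tape_at (x :: u) v ->
    runs (shift k Left) 1 S (qset k (tape_at u (x :: v)) S).
  move=> Sk; apply: runs_act.
  case: k Sk; case: S => [[[a b] c] d] /= ->; rewrite /puts /quad_of /=;
  by case: v => [|y v]; rewrite /tape_at /= /scons.
have shift_gap S v : qget k S = tape_at [::] v ->
    runs (shift k Left) 1 S (qset k (gap v) S).
  move=> Sk; apply: runs_act.
  case: k {shift_left} Sk; case: S => [[[a b] c] d] /= ->; rewrite /puts /quad_of /gap /=;
  by case: v => [|y v].
have loop u x v S : qget k S = tape_at u (x :: v) ->
    runs (While (fun c => isSome (qget k c)) (shift k Left)) (2 * size u + 3) S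
      (qset k (gap (rev u ++ x :: v)) S).
  elim: u x v S => [|y u IHu] x v S Sk /=.
    apply: (@runs_while _ _ 1 1 _ (qset k (gap (x :: v)) S)).
    - by rewrite qget_reads Sk.
    - exact: shift_gap.
    by apply: runs_while_end; rewrite qget_reads qget_qset.
  apply: (@leq_runs _ (2 + (2 * size u + 3))); first by lia.
  apply: (@runs_while _ _ 1 _ _ (qset k (tape_at u (y :: x :: v)) S)).
  - by rewrite qget_reads Sk.
  - exact: shift_left.
  rewrite rev_cons cat_rcons -(@qset_qset _ k (gap _) (tape_at u (y :: x :: v)) S).
  by apply: IHu; rewrite qget_qset.
move=> Tk.
have [T1 run1 run2] : exists2 T1, runs (shift k Left) 1 T T1 &
    runs (While (fun c => isSome (qget k c)) (shift k Left)) (2 * size l + 1) T1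
      (qset k (gap (rev l ++ r)) T).
  case: l Tk => [|x l] Tk.
    exists (qset k (gap r) T); first exact: shift_gap.
    by apply: runs_while_end; rewrite qget_reads qget_qset /= /read head_scons.
  exists (qset k (tape_at l (x :: r)) T); first exact: shift_left.
  apply: (@leq_runs _ (2 * size l + 3)); first by rewrite /=; lia.
  rewrite rev_cons cat_rcons -(@qset_qset _ k (gap _) (tape_at l (x :: r)) T).
  by apply: loop; rewrite qget_qset.
apply: (@leq_runs _ (1 + ((2 * size l + 1) + 1))); first by lia.
apply: runs_seq run1 _; apply: runs_seq run2 _; apply: runs_act.
case: k {shift_left shift_gap Tk loop};
  case: T => [[[a b] c] d]; rewrite /puts /quad_of /=;
  by rewrite /read /= head_scons behead_scons.
Qed.

(** The tapes are given as functions of the items already passed, in reverse order, and of those to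
    come, so that each use has only a single step to check. *)
Lemma runs_scan (A : Type) (s : seq A) (f : A -> bool)
    (E1 E2 E3 : seq A -> seq A -> tape) w l r :
  let bits u := [seq Bit (f x) | x <- u] in
  let I u v :=
    (tape_at (bits u ++ rev l) (bits v ++ Sep :: r), E1 u v, E2 u v, E3 u v) in
  (forall u x v, puts (I u (x :: v)) (w (reads (I u (x :: v)))) = I (x :: u) v) ->
  runs (scan w) (2 * size s + 2)
    (tape_at (rev l) (rcons (bits s) Sep ++ r), E1 [::] s, E2 [::] s, E3 [::] s)
    (tape_at (rev (l ++ rcons (bits s) Sep)) r,
     E1 (rev s) [::], E2 (rev s) [::], E3 (rev s) [::]).
Proof.
move=> bits I step_I.
apply: (@leq_runs _ ((size s * 2).+1 + 1)); first by lia.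
rewrite cat_rcons; apply: runs_seq.
  apply: (@runs_for _ s I) => [u x v _|//]; split=> //.
apply: runs_act.
by rewrite /puts /quad_of /tape_at /= rev_cat rev_rcons -map_rev.
Qed.

(** Only true bits of [T1] yield a letter: elements outside the union are not agents. *)
Definition emit_union (b : bool) : prog :=
  While (fun c => isSome (qget T1 c))
    (Act (fun c => (None, pass (qget T1 c), None,
                    if bit (qget T1 c) then write b else None))) ;;
  rewind T1.

Lemma runs_emit_union (A : Type) (s : seq A) (U : A -> bool) b a c o :
  runs (emit_union b) (4 * size s + 4)
    (a, tape_at [::] [seq Bit (U x) | x <- s], c, tape_at (rev o) [::])
    (a, tape_at [::] [seq Bit (U x) | x <- s], c,
     tape_at (rev (o ++ [seq Bit b | x <- s & U x])) [::]).
Proof.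
apply: (@leq_runs _ ((size s * 2).+1 + (2 * size s + 3))); first by lia.
pose I u v := (a, tape_at [seq Bit (U x) | x <- u] [seq Bit (U x) | x <- v], c,
  tape_at ([seq Bit b | x <- u & U x] ++ rev o) [::]).
apply: runs_seq (_ : runs _ _ _ (I (rev s) [::])) _.
  apply: (@runs_for _ s I) => [u x v _|//]; split=> //.
  by apply: runs_act; rewrite /puts /quad_of /I /=; case: (U x).
have := @runs_rewind T1 [seq Bit (U x) | x <- rev s] [::] (I (rev s) [::]) erefl.
rewrite size_map size_rev /I /= cats0 -map_rev revK rev_cat -map_rev.
by rewrite filter_rev.
Qed.

Definition emit_marks (h : bool -> bool) : prog :=
  While (fun c => isSome (qget T2 c))
    (Act (fun c => (None, None, pass (qget T2 c), write (h (bit (qget T2 c)))))) ;;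
  rewind T2.

Lemma runs_emit_marks (K : Type) (s : seq K) (V : K -> bool) h a b o :
  runs (emit_marks h) (4 * size s + 4)
    (a, b, tape_at [::] [seq Bit (V x) | x <- s], tape_at (rev o) [::])
    (a, b, tape_at [::] [seq Bit (V x) | x <- s],
     tape_at (rev (o ++ [seq Bit (h (V x)) | x <- s])) [::]).
Proof.
apply: (@leq_runs _ ((size s * 2).+1 + (2 * size s + 3))); first by lia.
pose I u v := (a, b, tape_at [seq Bit (V x) | x <- u] [seq Bit (V x) | x <- v],
  tape_at ([seq Bit (h (V x)) | x <- u] ++ rev o) [::]).
apply: runs_seq (_ : runs _ _ _ (I (rev s) [::])) _.
  apply: (@runs_for _ s I) => [u x v _|//]; split=> //.
have := @runs_rewind T2 [seq Bit (V x) | x <- rev s] [::] (I (rev s) [::]) erefl.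
by rewrite size_map size_rev /I /= cats0 -map_rev revK rev_cat -map_rev.
Qed.

Lemma runs_out x a b c o :
  runs (out x) 1 (a, b, c, tape_at (rev o) [::])
    (a, b, c, tape_at (rev (rcons o x)) [::]).
Proof. by apply: runs_act; rewrite rev_rcons. Qed.

Lemma map_const (A B : Type) (s : seq A) (y : B) :
  [seq y | _ <- s] = nseq (size s) y.
Proof. by elim: s => //= _ s ->. Qed.

(** * Programs that read the input and write the examples *)

Definition each (k : tape_index) (p : prog) : prog :=
  While (fun c => isSome (qget k c)) p.

(* [T1] holds the incidence vector of the union of the sets read so far, and
   [T2] one bit for each of the [budget + 1] marks, false at one mark only. *)
Definition read_universe : prog :=
  scan (fun c => (pass (qget T0 c), write false, None, None)) ;; rewind T1.

Definition unite : prog :=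
  scan (fun c => (pass (qget T0 c), write (bit (qget T0 c) || bit (qget T1 c)),
                  None, None)) ;;
  rewind T1.

(** The bit written before the scan turns the unary budget into [budget + 1] marks and is the one
    that is false. *)
Definition read_budget : prog :=
  Act (fun=> qset T2 (write false) idle) ;;
  scan (fun c => (pass (qget T0 c), None, write true, None)) ;; rewind T2.

Definition skip : prog :=
  scan (fun c => qset T0 (pass (qget T0 c)) idle).

(** Both negations come from [phi] being [true]: members of the set disagree, so their bits are
    flipped, and the only false mark becomes the only one to agree. *)
Definition set_example : prog :=
  scan (fun c => (pass (qget T0 c), pass (qget T1 c), None,
          if bit (qget T1 c) then write (~~ bit (qget T0 c)) else None)) ;;
  rewind T1 ;; emit_marks negb ;; out (Bit true) ;; out Sep.

(* The head of [T2] rests on the current mark between two examples; its bit is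
   turned to false while the example is copied out. *)
Definition mark_example : prog :=
  emit_union false ;;
  Act (fun=> qset T2 (Some (Some (Bit false), Stay)) idle) ;; rewind T2 ;;
  each T2 (Act (fun c =>
    (None, None, pass (qget T2 c), Some (qget T2 c, Right)))) ;;
  While (fun c => if qget T2 c is Some (Bit false) then false else true)
    (shift T2 Left) ;;
  Act (fun=> qset T2 (write true) idle) ;; out (Bit true) ;; out Sep.

(** Covers both formats in the input: incidence vectors, and unary numerals when [F] is constantly
    true. *)
Definition enc (A : Type) (s : seq A) (F : A -> bool) : word :=
  rcons [seq Bit (F x) | x <- s] Sep.

Lemma runs_read_universe (A : Type) (s : seq A) l r c d :
  runs read_universe (4 * size s + 5)
    (tape_at (rev l) (enc s (fun=> true) ++ r), tape_at [::] [::], c, d)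
    (tape_at (rev (l ++ enc s (fun=> true))) r,
     tape_at [::] [seq Bit false | x <- s], c, d).
Proof.
apply: (@leq_runs _ (2 * size s + 2 + (2 * size s + 3))); first by lia.
apply: runs_seq.
  by apply: (@runs_scan _ s (fun=> true)
    (fun u _ => tape_at [seq Bit false | x <- u] [::])
    (fun _ _ => c) (fun _ _ => d)).
have := @runs_rewind T1 [seq Bit false | _ <- rev s] [::]
  (tape_at (rev (l ++ enc s (fun=> true))) r,
   tape_at [seq Bit false | _ <- rev s] [::], c, d) erefl.
by rewrite size_map size_rev /= cats0 -map_rev revK.
Qed.

Lemma runs_unite (A : Type) (s : seq A) (F U : A -> bool) l r c d :
  runs unite (4 * size s + 5)
    (tape_at (rev l) (enc s F ++ r), tape_at [::] [seq Bit (U x) | x <- s], c, d)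
    (tape_at (rev (l ++ enc s F)) r,
     tape_at [::] [seq Bit (F x || U x) | x <- s], c, d).
Proof.
apply: (@leq_runs _ (2 * size s + 2 + (2 * size s + 3))); first by lia.
pose E u v := tape_at [seq Bit (F x || U x) | x <- u] [seq Bit (U x) | x <- v].
apply: runs_seq.
  exact: (@runs_scan _ s F E (fun _ _ => c) (fun _ _ => d)).
have := @runs_rewind T1 [seq Bit (F x || U x) | x <- rev s] [::]
  (tape_at (rev (l ++ enc s F)) r, E (rev s) [::], c, d) erefl.
by rewrite size_map size_rev /= cats0 -map_rev revK.
Qed.

(** Even over an empty ground set a separator is written, so the guard of a loop over the sets sees
    a nonblank cell before each set. *)
Lemma enc_cat_cons (A : Type) (s : seq A) F r : exists x v, enc s F ++ r = x :: v.
Proof. by case: s => [|x s]; [exists Sep, r | eexists _, _]. Qed.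

(** The union [U] collected so far is generalised in the induction on the sets. *)
Lemma runs_unites (A : Type) (s : seq A) (Fs : seq (A -> bool)) U l c d :
  runs (each T0 unite) (size Fs * (4 * size s + 6)).+1
    (tape_at (rev l) (flatten [seq enc s F | F <- Fs]),
     tape_at [::] [seq Bit (U x) | x <- s], c, d)
    (tape_at (rev (l ++ flatten [seq enc s F | F <- Fs])) [::],
     tape_at [::] [seq Bit (U x || has (fun F => F x) Fs) | x <- s], c, d).
Proof.
elim: Fs U l => [|F Fs IHFs] U l /=.
  rewrite cats0 (@eq_map _ _ _ (fun x => Bit (U x))) => [|x]; last first.
    by rewrite orbF.
  exact: runs_while_end.
apply: (@leq_runs _ ((4 * size s + 5).+1 + (size Fs * (4 * size s + 6)).+1)).
  by lia.
apply: runs_while (runs_unite _ _ _ _ _ _ _) _.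
  by have [x [v ->]] := enc_cat_cons s F (flatten [seq enc s F | F <- Fs]).
have := IHFs (fun x => F x || U x) (l ++ enc s F).
rewrite -catA.
have -> : [seq Bit (F x || U x || has (@^~ x) Fs) | x <- s] =
    [seq Bit (U x || (F x || has (@^~ x) Fs)) | x <- s].
  by apply: eq_map => x; rewrite orbCA orbA.
by [].
Qed.

Lemma runs_read_budget (K : eqType) (z : K) (zs : seq K) l r b d :
  z \notin zs ->
  runs read_budget (4 * size zs + 8)
    (tape_at (rev l) (enc zs (fun=> true) ++ r), b, tape_at [::] [::], d)
    (tape_at (rev (l ++ enc zs (fun=> true))) r, b,
     tape_at [::] [seq Bit (k != z) | k <- z :: zs], d).
Proof.
move=> z'zs.
apply: (@leq_runs _ (1 + (2 * size zs + 2 + (2 * (size zs).+1 + 3)))).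
  by lia.
pose E (u _ : seq K) := tape_at ([seq Bit true | _ <- u] ++ [:: Bit false]) [::].
apply: (runs_seq (T1 :=
  (tape_at (rev l) (enc zs (fun=> true) ++ r), b, E [::] zs, d))) => //.
apply: runs_seq.
  exact: (@runs_scan _ zs (fun=> true) (fun _ _ => b) E (fun _ _ => d)).
have := @runs_rewind T2 ([seq Bit true | _ <- rev zs] ++ [:: Bit false]) [::]
  (tape_at (rev (l ++ enc zs (fun=> true))) r, b, E (rev zs) [::], d) erefl.
rewrite size_cat addn1 size_map size_rev /= cats0.
rewrite (rev_cat [seq Bit true | _ <- rev zs]) -map_rev revK /= eqxx.
suff -> : [seq Bit (k != z) | k <- zs] = [seq Bit true | _ <- zs] by [].
by apply/eq_in_map => k k_zs; rewrite (memPn z'zs).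
Qed.

Lemma runs_skip (A : Type) (s : seq A) F l r b c d :
  runs skip (2 * size s + 2)
    (tape_at (rev l) (enc s F ++ r), b, c, d)
    (tape_at (rev (l ++ enc s F)) r, b, c, d).
Proof.
exact: (@runs_scan _ s F (fun _ _ => b) (fun _ _ => c) (fun _ _ => d)).
Qed.

Definition set_word (A K : Type) (s : seq A) (U : A -> bool) (zs : seq K)
    (V : K -> bool) (F : A -> bool) : word :=
  [seq Bit (~~ F x) | x <- s & U x] ++ [seq Bit (~~ V k) | k <- zs] ++
  [:: Bit true; Sep].

Lemma runs_set_example (A K : Type) (s : seq A) U (zs : seq K) V F l r o :
  runs set_example (4 * size s + 4 * size zs + 11)
    (tape_at (rev l) (enc s F ++ r), tape_at [::] [seq Bit (U x) | x <- s],
     tape_at [::] [seq Bit (V k) | k <- zs], tape_at (rev o) [::])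
    (tape_at (rev (l ++ enc s F)) r, tape_at [::] [seq Bit (U x) | x <- s],
     tape_at [::] [seq Bit (V k) | k <- zs],
     tape_at (rev (o ++ set_word s U zs V F)) [::]).
Proof.
apply: (@leq_runs _
  (2 * size s + 2 + (2 * size s + 3 + (4 * size zs + 4 + (1 + 1))))).
  by lia.
set c := tape_at [::] [seq Bit (V k) | k <- zs].
pose E u v := tape_at [seq Bit (U x) | x <- u] [seq Bit (U x) | x <- v].
pose O u (_ : seq A) := tape_at ([seq Bit (~~ F x) | x <- u & U x] ++ rev o) [::].
apply: runs_seq.
  apply: (@runs_scan _ s F E (fun _ _ => c) O) => u x v.
  by rewrite /E /O /=; case: (U x).
apply: (runs_seq (T1 := (tape_at (rev (l ++ enc s F)) r,
    tape_at [::] [seq Bit (U x) | x <- s], c,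
    tape_at (rev (o ++ [seq Bit (~~ F x) | x <- s & U x])) [::]))).
  have := @runs_rewind T1 [seq Bit (U x) | x <- rev s] [::]
    (tape_at (rev (l ++ enc s F)) r, E (rev s) [::], c, O (rev s) [::]) erefl.
  rewrite size_map size_rev /= cats0 -map_rev revK /O (rev_cat o) -map_rev.
  by rewrite filter_rev.
apply: runs_seq (runs_emit_marks _ _ _ _ _ _) _.
apply: runs_seq (runs_out _ _ _ _ _) _.
have := runs_out Sep (tape_at (rev (l ++ enc s F)) r)
  (tape_at [::] [seq Bit (U x) | x <- s]) c (rcons ((o ++ [seq Bit (~~ F x) | x <- s & U x]) ++
  [seq Bit (~~ V x) | x <- zs]) (Bit true)).
by rewrite -!cats1 /set_word -!catA.
Qed.

Lemma runs_set_examples (A K : Type) (s : seq A) U (zs : seq K) V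
    (Fs : seq (A -> bool)) l o :
  runs (each T0 set_example) (size Fs * (4 * size s + 4 * size zs + 12)).+1
    (tape_at (rev l) (flatten [seq enc s F | F <- Fs]),
     tape_at [::] [seq Bit (U x) | x <- s],
     tape_at [::] [seq Bit (V k) | k <- zs], tape_at (rev o) [::])
    (tape_at (rev (l ++ flatten [seq enc s F | F <- Fs])) [::],
     tape_at [::] [seq Bit (U x) | x <- s],
     tape_at [::] [seq Bit (V k) | k <- zs],
     tape_at (rev (o ++ flatten [seq set_word s U zs V F | F <- Fs])) [::]).
Proof.
elim: Fs l o => [|F Fs IHFs] l o /=; first by rewrite !cats0; apply: runs_while_end.
apply: (@leq_runs _ ((4 * size s + 4 * size zs + 11).+1 +
                     (size Fs * (4 * size s + 4 * size zs + 12)).+1)).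
  by lia.
apply: runs_while (runs_set_example _ _ _ _ _ _ _ _) _.
  by have [x [v ->]] := enc_cat_cons s F (flatten [seq enc s F | F <- Fs]).
by rewrite !catA; apply: IHFs.
Qed.

Definition mark_word (A : Type) (K : eqType) (s : seq A) (U : A -> bool)
    (zs : seq K) (z : K) : word :=
  [seq Bit false | x <- s & U x] ++ [seq Bit (k != z) | k <- zs] ++
  [:: Bit true; Sep].

(** The marks in [u] are done, [z] is current and [v] is waiting. The old bit [y] of [z] is
    arbitrary, because the first mark comes in false and the later ones true. *)
Lemma runs_mark_example (A : Type) (K : eqType) (s : seq A) U (u v : seq K) z y
    a o :
  uniq (rev u ++ z :: v) ->
  runs mark_example (4 * size s + 6 * size (rev u ++ z :: v) + 12)
    (a, tape_at [::] [seq Bit (U x) | x <- s],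
     tape_at [seq Bit true | _ <- u] (y :: [seq Bit true | _ <- v]),
     tape_at (rev o) [::])
    (a, tape_at [::] [seq Bit (U x) | x <- s],
     tape_at [seq Bit true | _ <- z :: u] [seq Bit true | _ <- v],
     tape_at (rev (o ++ mark_word s U (rev u ++ z :: v) z)) [::]).
Proof.
set zs := rev u ++ z :: v => uniq_zs.
set b := tape_at [::] [seq Bit (U x) | x <- s].
have marks w : z \notin w ->
    [seq Bit (k != z) | k <- w] = [seq Bit true | _ <- w].
  by move=> z'w; apply/eq_in_map => k k_w; rewrite (memPn z'w).
have [z'u z'v] : z \notin u /\ z \notin v.
  move: uniq_zs; rewrite /zs cat_uniq /= negb_or mem_rev.
  by case/and3P=> _ /andP[-> _] /andP[-> _].
have zsE : [seq Bit (k != z) | k <- zs] =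
    [seq Bit true | _ <- rev u] ++ Bit false :: [seq Bit true | _ <- v].
  by rewrite map_cat /= eqxx !marks ?mem_rev.
have rev_zsE : [seq Bit (k != z) | k <- rev zs] =
    [seq Bit true | _ <- rev v] ++ Bit false :: [seq Bit true | _ <- u].
  by rewrite map_rev zsE rev_cat rev_cons -!map_rev revK cat_rcons.
have size_zs : size zs = size u + (size v).+1 by rewrite size_cat size_rev.
apply: (@leq_runs _ (4 * size s + 4 + (1 + (2 * size u + 3 +
    ((size zs * 2).+1 + (2 * size v + 3 + (1 + (1 + 1)))))))); first by lia.
apply: runs_seq (runs_emit_union _ _ _ _ _ _) _.
set o1 := o ++ _.
apply: (runs_seq (T1 := (a, b, tape_at [seq Bit true | _ <- u]
  (Bit false :: [seq Bit true | _ <- v]), tape_at (rev o1) [::]))) => //.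
pose E w w' : quad tape := (a, b,
  tape_at [seq Bit (k != z) | k <- w] [seq Bit (k != z) | k <- w'],
  tape_at ([seq Bit (k != z) | k <- w] ++ rev o1) [::]).
apply: (runs_seq (T1 := E [::] zs)).
  have := @runs_rewind T2 [seq Bit true | _ <- u]
    (Bit false :: [seq Bit true | _ <- v]) (a, b, tape_at [seq Bit true | _ <- u]
    (Bit false :: [seq Bit true | _ <- v]), tape_at (rev o1) [::]) erefl.
  by rewrite size_map /E zsE /= -map_rev.
apply: (runs_seq (T1 := E (rev zs) [::])); first exact: runs_for.
pose o2 := o1 ++ [seq Bit (k != z) | k <- zs].
have -> : E (rev zs) [::] = (a, b, tape_at ([seq Bit true | _ <- rev v] ++
    Bit false :: [seq Bit true | _ <- u]) [::], tape_at (rev o2) [::]).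
  by rewrite /E /o2 rev_cat -map_rev rev_zsE.
(* Copying leaves the head on the blank after the last mark, so a blank cannot end the way back; the
   only false bit, that of [z], does. *)
have back w w' : (if w' is Bit false :: _ then false else true) ->
    runs (While (fun c => if qget T2 c is Some (Bit false) then false else true)
      (shift T2 Left)) (2 * size w + 3)
    (a, b, tape_at ([seq Bit true | _ <- w] ++
       Bit false :: [seq Bit true | _ <- u]) w', tape_at (rev o2) [::])
    (a, b, tape_at [seq Bit true | _ <- u]
       (Bit false :: [seq Bit true | _ : K <- w] ++ w'), tape_at (rev o2) [::]).
  elim: w w' => [|k w IHw] w' w'0 /=.
    apply: (@runs_while _ _ 1 1); last exact: runs_while_end.
      by case: w' w'0 => [|[[]|] w'].
    by case: w' {w'0} => [|x w'].
  apply: (@leq_runs _ (2 + (2 * size w + 3))); first by lia.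
  apply: (@runs_while _ _ 1 _ _ (a, b, tape_at ([seq Bit true | _ <- w] ++
       Bit false :: [seq Bit true | _ <- u]) (Bit true :: w'),
       tape_at (rev o2) [::])).
  - by case: w' w'0 => [|[[]|] w'].
  - by case: w' {w'0} => [|x w'].
  have := IHw (Bit true :: w') isT.
  suff -> : [seq Bit true | _ <- w] ++ Bit true :: w' =
      Bit true :: [seq Bit true | _ <- w] ++ w' by [].
  by elim: (w) => //= _ t ->.
have := back (rev v) [::] isT; rewrite cats0 size_rev => run_back.
apply: runs_seq run_back _.
apply: (runs_seq (T1 := (a, b, tape_at [seq Bit true | _ <- z :: u]
  [seq Bit true | _ <- v], tape_at (rev o2) [::]))).
  by apply: runs_act; rewrite [map _ (rev v)]map_const size_rev -map_const.
apply: runs_seq (runs_out _ _ _ _ _) _.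
have := runs_out Sep a b (tape_at [seq Bit true | _ <- z :: u]
  [seq Bit true | _ <- v]) (rcons o2 (Bit true)).
by rewrite -!cats1 /o2 /o1 /mark_word -!catA.
Qed.

Lemma runs_mark_examples (A : Type) (K : eqType) (s : seq A) U (u v : seq K) z y
    a o :
  let zs := rev u ++ z :: v in
  uniq zs ->
  runs (each T2 mark_example)
    (size (z :: v) * (4 * size s + 6 * size zs + 13)).+1
    (a, tape_at [::] [seq Bit (U x) | x <- s],
     tape_at [seq Bit true | _ <- u] (y :: [seq Bit true | _ <- v]),
     tape_at (rev o) [::])
    (a, tape_at [::] [seq Bit (U x) | x <- s],
     tape_at [seq Bit true | _ <- rev zs] [::],
     tape_at (rev (o ++ flatten [seq mark_word s U zs k | k <- z :: v])) [::]).
Proof.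
move=> zs; set c := _ + 13 => uniq_zs.
elim: v u z y o @zs @c uniq_zs => [|z' v IHv] u z y o zs c uniq_zs.
  apply: (@leq_runs _ ((4 * size s + 6 * size zs + 12).+1 + 1)).
    by rewrite /c /=; lia.
  apply: runs_while (@runs_mark_example _ _ _ _ u [::] z _ _ _ uniq_zs) _ => //.
  by rewrite /zs (rev_cat (rev u)) revK /= cats0; apply: runs_while_end.
apply: (@leq_runs _ ((4 * size s + 6 * size zs + 12).+1 +
    (size (z' :: v) * c).+1)); first by rewrite /c /=; lia.
apply: runs_while (@runs_mark_example _ _ _ _ u (z' :: v) z _ _ _ uniq_zs) _ => //.
(* Moving [z] to the marks done leaves the list of all marks, and so the cost of a round,
   unchanged. *)
have zsE : rev (z :: u) ++ z' :: v = zs by rewrite rev_cons cat_rcons.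
have := IHv (z :: u) z' (Bit true) (o ++ mark_word s U zs z).
rewrite zsE [flatten (map _ (z :: _))]/= catA.
by apply.
Qed.

Lemma size_flatten_map (A B : Type) (h : A -> seq B) (s : seq A) c :
  (forall x, size (h x) <= c) -> size (flatten [seq h x | x <- s]) <= size s * c.
Proof.
by move=> h_c; elim: s => //= x s IHs; rewrite size_cat mulSn leq_add.
Qed.

(** * The programs for the reduction and for the recovery *)

(** Two passes over the sets are made, as the whole union must be known before any example is
    written. The two [skip] pass the numerals; then come the unary number of agents, the example
    where exactly the marks disagree, and the examples for sets and for marks. *)
Definition reduce_prog : prog :=
  read_universe ;; read_budget ;; each T0 unite ;;
  rewind T0 ;; skip ;; skip ;;
  emit_union true ;; emit_marks (fun=> true) ;; out Sep ;;
  emit_union true ;; emit_marks (fun=> false) ;; out (Bit true) ;; out Sep ;;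
  each T0 set_example ;; each T2 mark_example ;; rewind T3.

Definition reduce_word (A : Type) (K : eqType) (s : seq A) (z : K) (zs : seq K)
    (Fs : seq (A -> bool)) : word :=
  let U x := has (fun F => F x) Fs in
  [seq Bit true | x <- s & U x] ++ [seq Bit true | _ <- z :: zs] ++ [:: Sep] ++
  [seq Bit true | x <- s & U x] ++ [seq Bit false | _ <- z :: zs] ++
  [:: Bit true; Sep] ++
  flatten [seq set_word s U (z :: zs) (fun k => k != z) F | F <- Fs] ++
  flatten [seq mark_word s U (z :: zs) k | k <- z :: zs].

(** Needed because the final rewind of [T3] takes time linear in the output. The second factor
    counts the numeral, the first example, the sets and the [size zs + 1] marks. *)
Lemma size_reduce_word (A : Type) (K : eqType) (s : seq A) (z : K) zs Fs :
  size (reduce_word s z zs Fs) <=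
    (size s + size zs + 3) * (size Fs + size zs + 3).
Proof.
have size_set U (V : K -> bool) F :
    size (set_word s U (z :: zs) V F) <= size s + size zs + 3.
  rewrite !size_cat !size_map size_filter /=.
  by have := count_size [eta U] s; lia.
have size_mark U k : size (mark_word s U (z :: zs) k) <= size s + size zs + 3.
  rewrite !size_cat !size_map size_filter /=.
  by have := count_size [eta U] s; lia.
rewrite /reduce_word; set U := fun x => has _ _.
set S := flatten _; set M := flatten _.
have S_le : size S <= size Fs * (size s + size zs + 3) by apply: size_flatten_map.
have M_le : size M <= size (z :: zs) * (size s + size zs + 3).
  exact: size_flatten_map.
move: S M S_le M_le => S M S_le M_le.
rewrite !size_cat !size_map !size_filter /=.
by have := count_size U s; move: M_le; rewrite /=; lia.
Qed.

Lemma runs_reduce (A : Type) (K : eqType) (s : seq A) (z : K) zs Fs :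
  let i := enc s (fun=> true) ++ enc zs (fun=> true) ++
           flatten [seq enc s F | F <- Fs] in
  uniq (z :: zs) ->
  exists2 T, qget T3 T = tape_at [::] (reduce_word s z zs Fs) &
    runs reduce_prog (100 * (size i).+1 ^ 2)
      (tape_at [::] i, tape_at [::] [::], tape_at [::] [::], tape_at [::] [::]) T.
Proof.
move=> i uniq_zs; pose U x := has (fun F => F x) Fs.
pose ms := z :: zs; pose V k := k != z.
pose b := tape_at [::] [seq Bit (U x) | x <- s].
pose c := tape_at [::] [seq Bit (V k) | k <- ms].
pose Tf := (tape_at (rev i) [::], b, tape_at [seq Bit true | _ <- rev ms] [::],
  tape_at (rev (reduce_word s z zs Fs)) [::]).
exists (qset T3 (tape_at [::] (rev (rev (reduce_word s z zs Fs)) ++ [::])) Tf).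
  by rewrite revK cats0.
set n := size s; set d := size zs; set m := size Fs.
(* Each set takes at least its separator, so the input length dominates each of [n], [d] and [m],
   and its square every product in the time bound. *)
have size_i : size i = n.+1 + d.+1 + m * n.+1.
  rewrite /i /enc !size_cat !size_rcons !size_map -/n -/d addnA; congr (_ + _).
  by rewrite /m; elim: (Fs) => //= F t IH; rewrite size_cat IH size_rcons size_map.
apply: (@leq_runs _ (4 * n + 5 + (4 * d + 8 + ((m * (4 * n + 6)).+1 +
  (2 * size (rev i) + 3 + (2 * n + 2 + (2 * d + 2 + (4 * n + 4 +
  (4 * d.+1 + 4 + (1 + (4 * n + 4 + (4 * d.+1 + 4 + (1 + (1 +
  ((m * (4 * n + 4 * d.+1 + 12)).+1 + ((d.+1 * (4 * n + 6 * d.+1 + 13)).+1 +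
  (2 * size (rev (reduce_word s z zs Fs)) + 3))))))))))))))))).
  rewrite !size_rev; have := size_reduce_word s z zs Fs.
  rewrite -/n -/d -/m; move: (size (reduce_word _ _ _ _)) => o.
  move: size_i; move: (size i) => N ->; nia.
apply: runs_seq; first exact: (@runs_read_universe _ s [::]).
apply: runs_seq.
  by apply: (runs_read_budget (z := z)); have /andP[] := uniq_zs.
apply: runs_seq; first exact: runs_unites.
set l := ([::] ++ _) ++ _; have -> : l ++ flatten [seq enc s F | F <- Fs] = i.
  by rewrite /l /i -!catA.
apply: runs_seq.
  exact: (@runs_rewind T0 (rev i) [::] (tape_at (rev i) [::], _, _, _) erefl).
rewrite revK cats0 /=.
apply: runs_seq; first exact: (@runs_skip _ s _ [::]).
apply: runs_seq; first exact: runs_skip.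
rewrite cat0s.
apply: runs_seq; first exact: (@runs_emit_union _ s U true _ _ [::]).
apply: runs_seq; first exact: (@runs_emit_marks _ ms V).
apply: runs_seq; first exact: runs_out.
apply: runs_seq; first exact: runs_emit_union.
apply: runs_seq; first exact: (@runs_emit_marks _ ms V).
apply: runs_seq; first exact: runs_out.
apply: runs_seq; first exact: runs_out.
apply: runs_seq; first exact: runs_set_examples.
apply: runs_seq.
  (* The loop over the marks starts on the false bit of [z], which plays the part of the arbitrary
     old bit. *)
  have -> : [seq Bit (V k) | k <- ms] = Bit false :: [seq Bit true | _ <- zs].
    rewrite /= /V eqxx; congr (_ :: _); apply/eq_in_map => k k_zs.
    by have /andP[/memPn ->] := uniq_zs.
  exact: (@runs_mark_examples _ _ s U [::] zs z _ _ _ uniq_zs).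
have -> : (enc s (fun=> true) ++ enc zs (fun=> true)) ++
    flatten [seq enc s F | F <- Fs] = i by rewrite -catA.
set t := rev ((rcons _ _ ++ _) ++ _).
suff -> : t = rev (reduce_word s z zs Fs).
  exact: (@runs_rewind T3 _ _ Tf).
by rewrite /t /reduce_word -!cats1 !cat0s -!catA.
Qed.

(* [T2] holds the incidence vector of the set of influencers, whose first
   entries are indexed by the elements of the union. *)
Definition recover_prog : prog :=
  scan (fun c => (pass (qget T0 c), None, Some (qget T0 c, Right), None)) ;;
  rewind T2 ;; read_universe ;; skip ;; each T0 unite ;;
  each T1 (Act (fun c =>
    (None, pass (qget T1 c), if bit (qget T1 c) then pass (qget T2 c) else None,
     if bit (qget T1 c) then Some (qget T2 c, Right) else write false))) ;;
  out Sep ;; rewind T3.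

(** The bits for the union come first in the influencer vector. Taking one from [T2] at each true
    bit of [T1] puts them back in the places of their elements, and the bits [w] of the marks are
    left over. *)
Lemma runs_recover (A B K : Type) (s : seq A) (zs : seq K) (Fs : seq (A -> bool))
    (t : seq B) (G : B -> bool) (h : A -> bool) w :
  let U x := has (fun F => F x) Fs in
  let i := enc t G ++ enc s (fun=> true) ++ enc zs (fun=> true) ++
           flatten [seq enc s F | F <- Fs] in
  [seq Bit (G k) | k <- t] = [seq Bit (h x) | x <- s & U x] ++ w ->
  exists2 T, qget T3 T = tape_at [::] (enc s (fun x => U x && h x)) &
    runs recover_prog (100 * (size i).+1 ^ 2)
      (tape_at [::] i, tape_at [::] [::], tape_at [::] [::], tape_at [::] [::]) T.
Proof.
move=> U i def_w.
(* Loop invariant: the head of [T2] has passed one bit for each element of the union in [u]. *)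
pose E u v : quad tape := (tape_at (rev i) [::],
  tape_at [seq Bit (U x) | x <- u] [seq Bit (U x) | x <- v],
  tape_at [seq Bit (h x) | x <- u & U x] ([seq Bit (h x) | x <- v & U x] ++ w),
  tape_at [seq Bit (U x && h x) | x <- u] [::]).
pose Tf := qset T3 (tape_at (rev (enc s (fun x => U x && h x))) [::])
  (E (rev s) [::]).
exists (qset T3 (tape_at [::]
  (rev (rev (enc s (fun x => U x && h x))) ++ [::])) Tf).
  by rewrite revK cats0.
set n := size s; set d := size zs; set m := size Fs; set p := size t.
have size_i : size i = p.+1 + n.+1 + d.+1 + m * n.+1.
  rewrite /i /enc !size_cat !size_rcons !size_map -/n -/d -/p !addnA.
  congr (_ + _).
  by rewrite /m; elim: (Fs) => //= F r IH; rewrite size_cat IH size_rcons size_map.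
apply: (@leq_runs _ (2 * p + 2 + (2 * p + 3 + (4 * n + 5 + (2 * d + 2 +
  ((m * (4 * n + 6)).+1 + ((n * 2).+1 + (1 + (2 * n.+1 + 3))))))))).
  by rewrite size_i; nia.
apply: runs_seq.
  exact: (@runs_scan _ t G (fun _ _ => tape_at [::] [::])
    (fun u _ => tape_at [seq Bit (G k) | k <- u] [::])
    (fun _ _ => tape_at [::] [::]) _ [::]).
apply: runs_seq.
  rewrite /p -(size_rev t) -(size_map (fun k => Bit (G k)) (rev t)).
  exact: (@runs_rewind T2 [seq Bit (G k) | k <- rev t] [::]
    (_, _, tape_at _ [::], _) erefl).
rewrite cats0 -map_rev revK def_w /=.
apply: runs_seq; first exact: (@runs_read_universe _ s).
apply: runs_seq; first exact: runs_skip.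
apply: runs_seq; first exact: runs_unites.
set l := rev _; have -> : l = rev i by rewrite /l /i -!catA /enc def_w.
apply: runs_seq.
  by apply: (@runs_for _ s E) => // u x v _; split=> //; rewrite /E /=; case: (U x).
rewrite /E (map_rev (fun x => Bit (U x && h x))).
apply: runs_seq.
  exact: (@runs_out Sep _ _ _ [seq Bit (U x && h x) | x <- s]).
have := @runs_rewind T3 (rev (enc s (fun x => U x && h x))) [::] Tf erefl.
by rewrite size_rev size_rcons size_map.
Qed.

(** * The reduction *)

Lemma enum_filter (T : finType) (A : {set T}) : [seq x <- enum T | x \in A] = enum A.
Proof. by rewrite [enum A]/enum_mem -enumT. Qed.

Lemma map_enum_val (T : finType) (A : {set T}) :
  [seq enum_val k | k <- enum 'I_#|A|] = enum A.
Proof.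
(* [nth] needs a default element, so the empty set is treated apart. *)
case: (set_0Vmem A) => [->|[x0 x0A]].
  rewrite enum_set0; apply: size0nil.
  by rewrite size_map size_enum_ord cards0.
rewrite (eq_map (enum_val_nth x0)) (map_comp (nth x0 (enum A))) val_enum_ord.
by rewrite cardE map_nth_iota0 ?take_size.
Qed.

(** As lists of numbers, both sides are the interval from 0 to [m + n], cut at [m] on the right. *)
Lemma enum_ordD m n :
  enum 'I_(m + n) = [seq lshift n i | i <- enum 'I_m] ++
                    [seq rshift m j | j <- enum 'I_n].
Proof.
have val_enum k : [seq nat_of_ord i | i <- enum 'I_k] = iota 0 k.
  exact: val_enum_ord.
apply: (inj_map (@ord_inj _)); rewrite map_cat val_enum iotaD.
rewrite -(map_comp _ (@lshift m n)) -(map_comp _ (@rshift m n)).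
rewrite -(val_enum m) add0n; congr (_ ++ _).
by rewrite -[m in LHS]addn0 iotaDl -val_enum -(map_comp (addn m)).
Qed.

Lemma card_filterC (T : finType) (A : {set T}) (P : pred T) :
  #|[set x in A | P x]| + #|[set x in A | ~~ P x]| = #|A|.
Proof.
rewrite -(cardsID [set x | P x] A); congr (_ + _).
  by apply: eq_card => x; rewrite !inE.
by apply: eq_card => x; rewrite !inE andbC.
Qed.

(** Turns the integer sum into a comparison of cardinalities; [l j] itself says that [j] agrees,
    [phi] being [true]. *)
Lemma majorityE n (l : labelling n) (F : {set 'I_n}) :
  majority l F = (#|[set j in F | l j]| < #|[set j in F | ~~ l j]|).
Proof.
have count_F (P : pred 'I_n) :
    (\sum_(j in F) (P j)%:R = #|[set j in F | P j]|%:R :> int)%R.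
  rewrite -natr_sum -big_mkcondr sum1_card; congr _%:R%R.
  by apply: eq_card => j; rewrite !inE.
rewrite /majority sumrB !count_F subr_gt0 ltr_nat.
by congr (_ < _); apply: eq_card => j; rewrite !inE /phi eqb_id.
Qed.

(** * The influencer instance and its feasible sets *)

Section Reduction.

Variable x : hs_instance.

Let U := hs_union x.
Let d := budget x.

(** [lu] and [lz] tell who agrees. The elements of the union come first, numbered by their rank in
    [enum U], and the marks last. *)
Definition label (lu : pred 'I_(ground x)) (lz : pred 'I_d.+1) :
    labelling (#|U| + d.+1) :=
  [ffun j => match split j with inl k => lu (enum_val k) | inr k => lz k end].

Definition influencer_instance : fi_instance :=
  @FIInstance (#|U| + d.+1)
    ((label predT pred0, true) ::
     [seq (label (fun i => i \notin A) (pred1 ord0), true)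
       | A : {set 'I_(ground x)} <- sets x] ++
     [seq (label pred0 (predC1 z), true) | z <- enum 'I_d.+1]).

Definition chosen (F : {set 'I_(#|U| + d.+1)}) : {set 'I_(ground x)} :=
  [set enum_val k | k in [set k | lshift d.+1 k \in F]].

Definition marks (F : {set 'I_(#|U| + d.+1)}) : {set 'I_d.+1} :=
  [set k | rshift #|U| k \in F].

Lemma label_lshift lu lz k : label lu lz (lshift d.+1 k) = lu (enum_val k).
Proof. by rewrite ffunE (unsplitK (inl k)). Qed.

Lemma label_rshift lu lz k : label lu lz (rshift #|U| k) = lz k.
Proof. by rewrite ffunE (unsplitK (inr k)). Qed.

Lemma mem_chosen F k : (enum_val k \in chosen F) = (lshift d.+1 k \in F).
Proof. by rewrite mem_imset ?inE //; apply: enum_val_inj. Qed.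

Lemma chosen_sub F : chosen F \subset U.
Proof. by apply/subsetP=> _ /imsetP[k _ ->]; apply: enum_valP. Qed.

(** The boolean [b] treats both counts at once: agreeing influencers for [false], disagreeing ones
    for [true]. *)
Lemma card_label (b : bool) lu lz (F : {set 'I_(#|U| + d.+1)}) :
  #|[set j in F | b (+) label lu lz j]| =
  #|[set i in chosen F | b (+) lu i]| + #|[set k in marks F | b (+) lz k]|.
Proof.
rewrite -sum1_card big_split_ord /= !sum1dep_card; congr (_ + _).
  have -> : [set i in chosen F | b (+) lu i] = enum_val @:
      [set k : 'I_#|U| | lshift d.+1 k \in [set j in F | b (+) label lu lz j]].
    apply/setP=> i; rewrite inE; apply/andP/imsetP=> [[]|[k]].
      by case/imsetP=> k + ->; rewrite inE => Fk luk; exists k;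
        rewrite // !inE Fk label_lshift.
    by rewrite !inE label_lshift => /andP[Fk luk] ->; rewrite mem_chosen.
  by rewrite (card_imset _ enum_val_inj).
by apply: eq_card => k; rewrite !inE label_rshift.
Qed.

Lemma majority_label lu lz F :
  majority (label lu lz) F =
    (#|[set i in chosen F | lu i]| + #|[set k in marks F | lz k]| <
     #|[set i in chosen F | ~~ lu i]| + #|[set k in marks F | ~~ lz k]|).
Proof.
by rewrite majorityE (card_label false) (card_label true).
Qed.

Lemma card_pred1 (T : finType) (A : {set T}) (z : T) :
  #|[set k in A | k == z]| = (z \in A).
Proof.
case: (boolP (z \in A)) => zA.
  rewrite (_ : [set _ in _ | _] = [set z]) ?cards1 //; apply/setP=> k.
  by rewrite !inE; case: eqP => [->|]; rewrite ?zA ?andbF.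
apply/eqP; rewrite cards_eq0; apply/eqP/setP=> k; rewrite !inE.
by case: eqP => [->|]; rewrite ?(negPf zA) ?andbF.
Qed.

Lemma feasibleP F :
  feasible influencer_instance F <->
  marks F = setT /\ hitting_set x (chosen F).
Proof.
set C := chosen F; set Z := marks F.
have all_set (T : finType) (A : {set T}) : [set k in A | predT k] = A.
  by apply/setP=> k; rewrite inE andbT.
have no_set (T : finType) (A : {set T}) : [set k in A | pred0 k] = set0.
  by apply/setP=> k; rewrite !inE andbF.
have all_setN (T : finType) (A : {set T}) : [set k in A | ~~ pred0 k] = A.
  by apply/setP=> k; rewrite inE andbT.
have no_setN (T : finType) (A : {set T}) : [set k in A | ~~ predT k] = set0.
  by apply/setP=> k; rewrite !inE andbF.
have majB : majority (label predT pred0) F = (#|C| < #|Z|).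
  by rewrite majority_label all_set no_set all_setN no_setN !cards0 addn0.
have majZ (z : 'I_d.+1) : majority (label pred0 (predC1 z)) F =
    (#|[set k in Z | k != z]| < #|C| + (z \in Z)).
  rewrite majority_label no_set all_setN cards0 add0n -card_pred1.
  by congr (_ < _ + _); apply: eq_card => k; rewrite !inE negbK.
have majS (A : {set 'I_(ground x)}) :
    majority (label (fun i => i \notin A) (pred1 ord0)) F =
    (#|[set i in C | i \notin A]| + (ord0 \in Z) <
     #|A :&: C| + #|[set k in Z | k != ord0]|).
  rewrite majority_label -card_pred1.
  by congr (_ < _ + _); apply: eq_card => i; rewrite !inE negbK andbC.
have cardZ (z : 'I_d.+1) : (z \in Z) + #|[set k in Z | k != z]| = #|Z|.
  by rewrite -card_pred1 card_filterC.
have cardC (A : {set 'I_(ground x)}) : #|[set i in C | i \notin A]| + #|A :&: C| = #|C|.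
  rewrite -(card_filterC C (fun i => i \notin A)); congr (_ + _).
  by apply: eq_card => i; rewrite !inE negbK andbC.
split=> [feasF | [Z_T [_ C_d C_hit]]].
  have ltCZ : #|C| < #|Z| by rewrite -majB (feasF (_, _) (mem_head _ _)).
  have Z_T : Z = setT.
    apply/setP=> z; rewrite in_setT.
    have : majority (label pred0 (predC1 z)) F.
      apply: (feasF (_, true)); rewrite inE mem_cat; apply/orP; right.
      by apply/orP; right; apply/mapP; exists z; rewrite ?mem_enum.
    (* Without [z] in [Z], its example would give [#|Z| < #|C|], against [ltCZ]. *)
    rewrite majZ; have := cardZ z; case: (z \in Z) => //=.
    by rewrite add0n addn0 => ->; rewrite ltnNge ltnW.
  have C_d : #|C| = d.
    have : majority (label pred0 (predC1 ord0)) F.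
      apply: (feasF (_, true)); rewrite inE mem_cat; apply/orP; right.
      by apply/orP; right; apply/mapP; exists ord0; rewrite ?mem_enum.
    (* Now [#|Z| = d + 1]: the first example gives [#|C| <= d] and that of [ord0] gives
       [d < #|C| + 1]. *)
    rewrite majZ; have := cardZ ord0; move: ltCZ.
    by rewrite Z_T inE cardsT card_ord; lia.
  split=> //; split=> //; first exact: chosen_sub.
  move=> A A_x; rewrite -card_gt0.
  have : majority (label (fun i => i \notin A) (pred1 ord0)) F.
    apply: (feasF (_, true)); rewrite inE mem_cat; apply/orP; right.
    by apply/orP; left; apply/mapP; exists A.
  (* The inequality becomes [d - #|A :&: C| + 1 < #|A :&: C| + d], which fails for an empty
     intersection. *)
  rewrite majS; have := cardZ ord0; have := cardC A.
  by rewrite C_d Z_T inE cardsT card_ord; lia.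
(* Conversely, the first example and those of the marks all read [d < d + 1], and that of a set
   follows from its being hit. *)
have cardT (z : 'I_d.+1) : #|[set k in Z | k != z]| = d.
  by have := cardZ z; rewrite Z_T inE cardsT card_ord => -[].
move=> e; rewrite inE mem_cat => /orP[/eqP->|/orP[]].
- by rewrite majB C_d Z_T cardsT card_ord ltnSn.
- case/mapP=> A A_x ->; rewrite majS cardT Z_T inE.
  by have := C_hit A A_x; rewrite -card_gt0; have := cardC A; rewrite C_d /= -/d; lia.
by case/mapP=> z _ ->; rewrite majZ cardT Z_T C_d inE addn1 ltnSn.
Qed.

Lemma hitting_set_feasible C :
  hitting_set x C -> exists F, feasible influencer_instance F.
Proof.
move=> C_hit; have [/subsetP C_U _ _] := C_hit.
(* The influencers are the elements of [C] and all marks; as [C] lies in the union, [chosen] loses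
   none of its elements. *)
pose F := [set j : 'I_(#|U| + d.+1) |
  match split j with inl k => enum_val k \in C | inr _ => true end].
exists F; apply/feasibleP; split.
  by apply/setP=> k; rewrite !inE (unsplitK (inr k)).
suff -> : chosen F = C by [].
have chosenF (k : 'I_#|U|) : (enum_val k \in chosen F) = (enum_val k \in C).
  by rewrite mem_chosen inE (unsplitK (inl k)).
apply/setP=> i; apply/idP/idP=> Ci.
  have := subsetP (chosen_sub F) i Ci => Ui.
  by rewrite -(enum_rankK_in Ui Ui) -chosenF enum_rankK_in.
by rewrite -(enum_rankK_in (C_U i Ci) (C_U i Ci)) chosenF enum_rankK_in ?C_U.
Qed.

(** * The encodings as words read and written by the programs *)

Let s := enum 'I_(ground x).
(** Serves both as the unary budget and as the list of marks other than [ord0]. *)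
Let zs := [seq lift ord0 i | i <- enum 'I_d].
Let Fs := [seq (fun i => i \in A) | A : {set 'I_(ground x)} <- sets x].

Lemma enum_marks : enum 'I_d.+1 = ord0 :: zs.
Proof. exact: enum_ordSl. Qed.

Lemma enc_hsE :
  enc_hs x = enc s (fun=> true) ++ enc zs (fun=> true) ++
             flatten [seq enc s F | F <- Fs].
Proof.
rewrite /enc_hs /enc_nat /enc !map_const /zs size_map /s !size_enum_ord -/d.
by rewrite -(map_comp (enc _)).
Qed.

Lemma mem_hs_union i : (i \in U) = has (fun F => F i) Fs.
Proof.
rewrite /U /hs_union /Fs has_map.
elim: (sets x) => [|A t IH]; first by rewrite big_nil inE.
by rewrite big_cons inE IH.
Qed.

Lemma enum_hs_union : [seq i <- s | has (fun F => F i) Fs] = enum U.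
Proof. by rewrite -enum_filter; apply: eq_filter => i; rewrite -mem_hs_union. Qed.

Lemma enc_label lu lz :
  enc_example (label lu lz, true) =
  [seq Bit (lu i) | i <- enum U] ++ [seq Bit (lz k) | k <- enum 'I_d.+1] ++
  [:: Bit true; Sep].
Proof.
rewrite /enc_example enum_ordD map_cat -(map_comp _ (lshift _)).
rewrite -(map_comp _ (@rshift _ _)) -catA -map_enum_val -(map_comp _ enum_val).
congr (_ ++ (_ ++ _)).
  by apply: eq_map => k /=; rewrite label_lshift /phi eqb_id.
by apply: eq_map => k /=; rewrite label_rshift /phi eqb_id.
Qed.

Lemma enc_influencer_instance :
  enc_fi influencer_instance = reduce_word s ord0 zs Fs.
Proof.
rewrite /enc_fi /reduce_word enum_hs_union -enum_marks /= map_cat flatten_cat.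
rewrite enc_label /enc_nat -cats1 nseqD -!catA !map_const -cardE size_enum_ord.
congr (_ ++ (_ ++ (_ :: (_ ++ (_ ++ (_ :: (_ :: (_ ++ _)))))))).
  congr flatten; rewrite /Fs -!map_comp; apply: eq_map => A /=.
  by rewrite enc_label /set_word enum_hs_union; congr (_ ++ (_ ++ _));
    apply: eq_map => k /=; rewrite negbK.
by congr flatten; rewrite -map_comp; apply: eq_map => z /=;
  rewrite enc_label /mark_word enum_hs_union.
Qed.

(** The conjunction, which is the form of the output of [recover_prog], is harmless because
    [chosen F] lies in the union. *)
Lemma enc_chosen F :
  enc_set (chosen F) =
  enc s (fun i => has (fun G => G i) Fs && (i \in chosen F)).
Proof.
rewrite /enc_set /enc; congr rcons; apply: eq_map => i; congr Bit.
rewrite -mem_hs_union; case Ci: (i \in chosen F); rewrite ?andbF //.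
by rewrite (subsetP (chosen_sub F) i Ci).
Qed.

(** Provides the splitting assumed by [runs_recover], with the bits of the marks as the
    remainder. *)
Lemma enc_influencers (F : {set 'I_(#|U| + d.+1)}) :
  [seq Bit (j \in F) | j <- enum 'I_(#|U| + d.+1)] =
  [seq Bit (i \in chosen F) | i <- s & has (fun G => G i) Fs] ++
  [seq Bit (k \in marks F) | k <- enum 'I_d.+1].
Proof.
rewrite enum_hs_union -map_enum_val enum_ordD map_cat -(map_comp _ (lshift _)).
rewrite -(map_comp _ (@rshift _ _)) -(map_comp _ enum_val).
congr (_ ++ _); apply: eq_map => k /=; first by rewrite mem_chosen.
by rewrite inE.
Qed.

End Reduction.

Local Definition time_bound : {poly nat} := (100%N%:P * ('X + 1) ^+ 2)%R.

Lemma time_boundE n : time_bound.[n]%R = 100 * n.+1 ^ 2.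
Proof. by rewrite hornerM horner_exp hornerD hornerX !hornerC natrXE natrDE addn1. Qed.

Theorem theorem5 :
  exists (f : hs_instance -> fi_instance)
         (g : forall x : hs_instance,
                {set 'I_(others (f x))} -> {set 'I_(ground x)}),
  [/\ polytime enc_hs (fun x => enc_fi (f x)),
      polytime
        (fun xF : {x : hs_instance & {set 'I_(others (f x))}} =>
           enc_set (projT2 xF) ++ enc_hs (projT1 xF))
        (fun xF : {x : hs_instance & {set 'I_(others (f x))}} =>
           enc_set (g (projT1 xF) (projT2 xF))) &
      forall x : hs_instance,
        let n := #|hs_union x| + budget x + 1 in
        let m := size (sets x) in
        [/\ agents (f x) = n + 1,
            size (examples (f x)) = m + budget x + 2,
            (exists C : {set 'I_(ground x)}, hitting_set x C) <->
              (exists F : {set 'I_(others (f x))}, feasible (f x) F) &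
            forall F : {set 'I_(others (f x))},
              feasible (f x) F -> hitting_set x (g x F)]].
Proof.
exists influencer_instance, chosen; split.
- apply: (polytime_prog (p := reduce_prog) (q := time_bound)) => x.
  rewrite time_boundE enc_influencer_instance enc_hsE; apply: runs_reduce.
  by rewrite -enum_marks enum_uniq.
- apply: (polytime_prog (p := recover_prog) (q := time_bound)) => -[x F] /=.
  rewrite time_boundE enc_chosen enc_hsE.
  by apply: runs_recover; apply: enc_influencers.
move=> x n m; split.
- by rewrite /agents /= /n addnS !addn1.
- by rewrite /= size_cat 2!size_map size_enum_ord /m addnS addn2.
- split=> [[C] | [F]]; first exact: hitting_set_feasible.
  by case/feasibleP=> _ C_hit; exists (chosen F).
by move=> F /feasibleP[].
Qed.
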